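(* Let $d\geq 1$ be an integer. For Lebesgue-almost every $\mathbf{x}\in\mathbb{R}^d$ one has \[ \omega_{H_{\max}}(\mathbf{x})=\omega_{H_{\mathrm{prod}^{1/d}}}(\mathbf{x})=\omega_{H_{\min}}(\mathbf{x})=2 . \]
   Context: Every rational point $\mathbf{r}\in\mathbb{Q}^d$ is written uniquely as $\mathbf{r}=(p_1/q_1,\dots,p_d/q_d)$ with each $p_i/q_i$ in lowest terms, $p_i\in\mathbb{Z}$, $q_i\in\mathbb{N}$; write $\mathbf{q}=(q_1,\dots,q_d)$. Define the height functions $H_{\max}(\mathbf{r})=\max(q_1,\dots,q_d)$, $H_{\min}(\mathbf{r})=\min(q_1,\dots,q_d)$, and $H_{\mathrm{prod}^{1/d}}(\mathbf{r})=(q_1q_2\cdots q_d)^{1/d}$. The norm $\|\cdot\|$ on $\mathbb{R}^d$ is the max norm. For a height function $H$ and a point $\mathbf{x}\in\mathbb{R}^d\setminus\mathbb{Q}^d$, the exponent of irrationality $\omega_H(\mathbf{x})$ is the supremum of all $\tau\geq 0$ such that there exists a sequence $(\mathbf{r}_n)$ in $\mathbb{Q}^d$ with $\mathbf{r}_n\to\mathbf{x}$ and $\|\mathbf{x}-\mathbf{r}_n\|<H(\mathbf{r}_n)^{-\tau}$ for all $n$. *)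

(* Defs.v *)
From HB Require Import structures.
From mathcomp Require Import all_boot all_order all_algebra.
From mathcomp Require Import all_classical all_reals all_analysis.

Set Implicit Arguments.
Unset Strict Implicit.
Unset Printing Implicit Defensive.

Import Order.TTheory GRing.Theory Num.Theory.
Import numFieldNormedType.Exports.

Local Open Scope classical_set_scope.
Local Open Scope ring_scope.

Section tuple_measure_cons.
Local Open Scope ereal_scope.
Context {R : realType} {d} {T : measurableType d} (n : nat).
Variable m : {sigma_finite_measure set T -> \bar R}.
Variable mu : {sigma_finite_measure set (n.-tuple T) -> \bar R}.

Let consT (z : T * n.-tuple T) : n.+1.-tuple T := [tuple of z.1 :: z.2].

Let unconsT (t : n.+1.-tuple T) : T * n.-tuple T :=
  (tnth t ord0, [tuple of behead t]).

Let measurable_consT : measurable_fun setT consT.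
Proof. exact: measurable_cons. Qed.

Let measurable_unconsT : measurable_fun setT unconsT.
Proof.
apply/measurable_fun_pairP; split; first exact: measurable_tnth.
exact: measurable_behead.
Qed.

(* The measure m x mu, transported along T * T^n ~ T^(n+1). *)
Definition tuple_measure_cons : set (n.+1.-tuple T) -> \bar R :=
  pushforward (m \x mu) consT.

Let tuple_measure_cons0 : tuple_measure_cons set0 = 0.
Proof. by rewrite /tuple_measure_cons /pushforward preimage_set0 measure0. Qed.

Let tuple_measure_cons_ge0 A : 0 <= tuple_measure_cons A.
Proof. exact: measure_ge0. Qed.

Let tuple_measure_cons_sigma_additive : semi_sigma_additive tuple_measure_cons.
Proof.
move=> F mF tF mUF; rewrite /tuple_measure_cons /pushforward preimage_bigcup.
apply: measure_semi_sigma_additive.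
- by move=> k; rewrite -[X in measurable X]setTI; exact: measurable_consT.
- apply/trivIsetP => /= i j _ _ ij; rewrite -preimage_setI.
  by move/trivIsetP : tF => /(_ _ _ _ _ ij) ->//; rewrite preimage_set0.
- by rewrite -preimage_bigcup -[X in measurable X]setTI; exact: measurable_consT.
Qed.

HB.instance Definition _ := isMeasure.Build _ _ _ tuple_measure_cons
  tuple_measure_cons0 tuple_measure_cons_ge0 tuple_measure_cons_sigma_additive.

Lemma tuple_measure_consX (A : set T) (B : set (n.-tuple T)) :
  measurable A -> measurable B ->
  tuple_measure_cons [set t | A (tnth t ord0) /\ B [tuple of behead t]] =
  m A * mu B.
Proof.
move=> mA mB; rewrite -[RHS]product_measure1E//.
rewrite /tuple_measure_cons /pushforward; congr (_ _).
have consTK x t : [tuple of behead (consT (x, t))] = t :> n.-tuple T.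
  exact: val_inj.
by apply/seteqP; split => -[x t] [Ax Bt]; split=> //; move: Bt; rewrite /= consTK.
Qed.

Let tuple_measure_cons_sigma_finite : sigma_finite setT tuple_measure_cons.
Proof.
have /sigma_finiteP[F [TF ndF Foo]] := sigma_finiteT m.
have /sigma_finiteP[G [TG ndG Goo]] := sigma_finiteT mu.
exists (fun k => unconsT @^-1` (F k `*` G k)).
  apply/esym/seteqP; split => // t _.
  have [k _ Fk] : (\bigcup_k F k) (unconsT t).1 by rewrite -TF.
  have [l _ Gl] : (\bigcup_k G k) (unconsT t).2 by rewrite -TG.
  exists (maxn k l) => //; split => /=.
    by move: Fk; apply/subsetPset/ndF/leq_maxl.
  by move: Gl; apply/subsetPset/ndG/leq_maxr.
move=> k; have [mF Fk] := Foo k; have [mG Gk] := Goo k; split.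
  rewrite -[X in measurable X]setTI; apply: measurable_unconsT => //.
  exact: measurableX.
by rewrite [ltLHS]tuple_measure_consX// lte_mul_pinfty// ge0_fin_numE.
Qed.

HB.instance Definition _ := Measure_isSigmaFinite.Build _ _ _ tuple_measure_cons
  tuple_measure_cons_sigma_finite.

End tuple_measure_cons.

(* d-dimensional Lebesgue measure, as the d-fold product of lebesgue_measure
   (on the Borel sets of R^d). *)
Fixpoint lebesgue_tuple (R : realType) (d : nat) :
    {sigma_finite_measure set (d.-tuple (measurableTypeR R)) -> \bar R} :=
  match d with
  | 0 => (\d_ [tuple] : {sigma_finite_measure set _ -> \bar R})
  | d'.+1 => tuple_measure_cons (@lebesgue_measure R) (lebesgue_tuple R d')
  end.

Lemma lebesgue_tuple_box (R : realType) (d : nat)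
    (A : 'I_d -> set (measurableTypeR R)) :
  (forall i, measurable (A i)) ->
  lebesgue_tuple R d [set t | forall i, A i (tnth t i)] =
  (\prod_(i < d) @lebesgue_measure R (A i))%E.
Proof.
elim: d A => [|d IH] A mA /=.
  by rewrite big_ord0 diracE mem_set//; case.
rewrite big_ord_recl/= -IH//.
rewrite -[RHS]tuple_measure_consX//; last first.
  rewrite [X in measurable X](_ : _ =
    \bigcap_(i in [set: 'I_d]) (@tnth _ _ ^~ i @^-1` A (lift ord0 i))).
    apply: fin_bigcap_measurable => // i _.
    by rewrite -[X in measurable X]setTI; exact: measurable_tnth.
  by apply/seteqP; split => t /= Ht i; [move=> _|]; exact: Ht.
congr (_ _); apply/seteqP; split => t /=.
  move=> At; split => // i; rewrite (_ : tnth _ i = tnth t (lift ord0 i))//.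
  by rewrite [in RHS](tuple_eta t) tnthS.
move=> [A0 At] i; case: (unliftP ord0 i) => [j ->|->//].
by have := At j; rewrite [X in _ -> _ (tnth X _)](tuple_eta t) tnthS.
Qed.

Section heights.
Context {R : realType} {d : nat}.
Implicit Types r : 'rV[rat]_d.

(* denq is the positive denominator in lowest terms. *)
Definition denom r (i : 'I_d) : R := (denq (r ord0 i))%:~R.

Definition Hmax r : R := \big[Num.max/0]_(i < d) denom r i.

(* The default value Hmax r is only attained as a minimum when all the
   denominators are equal, so for d > 0 this is the minimum of the q_i. *)
Definition Hmin r : R := \big[Num.min/Hmax r]_(i < d) denom r i.

Definition Hprod r : R := (\prod_(i < d) denom r i) `^ (d%:R^-1).

End heights.

(* `|_| on 'rV[R]_d is the max norm. The exponent is meant for x outside Q^d;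
   the total function below takes the value +oo at rational points (constant
   sequences) for the heights above. *)
Definition irr_exponent (R : realType) (d : nat) (H : 'rV[rat]_d -> R)
    (x : 'rV[R]_d) : \bar R :=
  ereal_sup [set tau%:E | tau in [set tau : R | 0 <= tau /\
    exists r : nat -> 'rV[rat]_d,
      (map_mx ratr (r n) @[n --> \oo] --> x) /\
      forall n, `|x - map_mx ratr (r n)| < H (r n) `^ (- tau)]].

Definition row_of_tuple (T : Type) (d : nat) (t : d.-tuple T) : 'rV[T]_d :=
  \row_i tnth t i.

(* Main.v *)
(** Since Hmin <= Hprod <= Hmax, the exponents satisfy
    omega_Hmax <= omega_Hprod <= omega_Hmin, so it is enough to bound the outer
    two.  Almost every point has diophantine coordinates: for every e > 0,
    |x_i - p/q| >= c q^-(2+e) for some c > 0 and all p/q (a Borel-Cantelli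
    argument: the balls of radius c q^-(2+e) around the rationals in a bounded
    interval have total measure O(c)).

    For such a point, if |x - r| < Hmin(r)^-tau with tau > 2, then the
    coordinate with the smallest denominator q satisfies
    c q^-(2+e) < q^-tau, which bounds q and keeps r away from x.

    Conversely, Dirichlet's theorem gives, for each coordinate and each N, a
    fraction with q <= N and |x_i - p/q| < 1/(qN).  The diophantine condition
    forces q >= (cN)^(1/(1+e)), so this distance is below N^-tau for any
    tau < 2 and N large, uniformly in the coordinates, although they have
    different denominators. *)
Require Import Defs.
From mathcomp Require Import all_boot all_order all_algebra.
From mathcomp Require Import all_classical all_reals all_analysis.
From mathcomp Require Import lra zify.
Import Order.TTheory GRing.Theory Num.Theory.
Import numFieldNormedType.Exports.

Local Open Scope classical_set_scope.
Local Open Scope ring_scope.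

(** * Denominators and Dirichlet's theorem *)

Lemma denq_intr_gt0 {R : realType} (r : rat) : 0 < (denq r)%:~R :> R.
Proof. by rewrite ltr0z denq_gt0. Qed.

Lemma denq_intr_ge1 {R : realType} (r : rat) : 1 <= (denq r)%:~R :> R.
Proof. by rewrite ler1z -gtz0_ge1 denq_gt0. Qed.

(** Cross-multiplying, [denq r] divides [numq r * q]; being coprime to [numq r], it divides [q]. *)
Lemma denq_div_le (p : int) (q : nat) : (0 < q)%N ->
  denq (p%:~R / q%:R) <= q%:Z.
Proof.
move=> q0; set r := _ / _.
have rq : numq r * q%:Z = p * denq r.
  apply/eqP; rewrite -(eqr_int rat) !intrM.
  rewrite numqE /r mulrAC -pmulrn mulfVK//.
  by rewrite pnatr_eq0 -lt0n.
have : (denq r %| numq r * q%:Z)%Z by rewrite rq dvdz_mull.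
rewrite Gauss_dvdzr; last by rewrite coprimezE coprime_sym coprime_num_den.
move=> /(dvdn_leq q0); rewrite -(gtz0_abs (denq_gt0 r)).
by rewrite absz_nat lez_nat.
Qed.

(** Pigeonhole: among the fractional parts of [k * x] for [k <= N], two lie in the same one of [N]
    intervals of length [1/N]. *)
Lemma dirichlet {R : realType} (x : R) (N : nat) : (0 < N)%N ->
  exists r : rat, (denq r)%:~R <= N%:R :> R /\
    `|x - ratr r| < ((denq r)%:~R * N%:R)^-1.
Proof.
move=> N0; have N0R : 0 < N%:R :> R by rewrite ltr0n.
pose fp (k : nat) : R := k%:R * x - (Num.floor (k%:R * x))%:~R.
have fp0 k : 0 <= fp k by rewrite subr_ge0 floor_le.
have fp1 k : fp k < 1.
  by rewrite /fp ltrBlDl; have := floorD1_gt (k%:R * x); rewrite intrD.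
pose b k := Num.truncn (N%:R * fp k).
have b_itv k : (b k)%:R <= N%:R * fp k < (b k).+1%:R.
  by apply: truncn_itv; rewrite mulr_ge0.
have bN k : (b k < N)%N.
  rewrite -(ltr_nat R); have /andP[+ _] := b_itv k.
  by move=> /le_lt_trans; apply; rewrite gtr_pMr.
pose g (k : 'I_N.+1) : 'I_N := Ordinal (bN k).
have /injectivePn[k [l]] : ~~ injectiveb g.
  by apply/negP => /injectiveP/leq_card; rewrite !card_ord ltnn.
wlog kl : k l / (k < l)%N.
  move=> H kl gkl; have [kl'|lk|/val_inj klE] := ltngtP k l.
    exact: (H k l kl').
    by apply: (H l k lk); rewrite // eq_sym.
  by rewrite klE eqxx in kl.
move=> _ /(congr1 val)/= bkl.
pose q := (l - k)%N; have q0 : (0 < q)%N by rewrite subn_gt0.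
have q0R : 0 < q%:R :> R by rewrite ltr0n.
pose p := Num.floor (l%:R * x) - Num.floor (k%:R * x).
have fpB : fp l - fp k = q%:R * x - p%:~R.
  by rewrite /fp natrB 1?ltnW// intrB; lra.
have fpN : N%:R * `|fp l - fp k| < 1.
  rewrite -[X in X * _]gtr0_norm// -normrM mulrBr ltr_norml.
  have := b_itv k; have := b_itv l; rewrite bkl -natr1 => /andP[? ?] /andP[? ?].
  by apply/andP; split; lra.
(* [p / q] need not be reduced, but its reduced denominator is at most [q], so both bounds pass to
   it. *)
exists (p%:~R / q%:R); have dq : (denq (p%:~R / q%:R))%:~R <= q%:R :> R.
  by rewrite [leRHS]pmulrn ler_int denq_div_le.
split.
  by rewrite (le_trans dq)// ler_nat (leq_trans (leq_subr _ _))// -ltnS.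
rewrite fmorph_div/= ratr_int ratr_nat.
rewrite (@lt_le_trans _ _ (q%:R * N%:R)^-1)//; last first.
  rewrite lef_pV2 ?posrE ?mulr_gt0// ?denq_intr_gt0//.
  by rewrite ler_wpM2r.
have -> : x - p%:~R / q%:R = (fp l - fp k) / q%:R.
  by rewrite fpB mulrBl mulrAC mulfV ?mul1r// gt_eqF.
rewrite normrM normfV (gtr0_norm q0R) invfM mulrC ltr_pM2l ?invr_gt0//.
by rewrite -[ltRHS]mul1r ltr_pdivlMr// mulrC.
Qed.

(** * Max norm and real powers *)

Section norm_rV.
Context {R : realType} {d : nat}.
Implicit Type x : 'rV[R]_d.

Lemma rV_norm_lt x (e : R) : 0 < e -> (forall i, `|x ord0 i| < e) -> `|x| < e.
Proof.
move=> e0 xe; rewrite -[ltLHS]/(mx_norm x) mx_normrE.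
apply/bigmax_ltP; split => //.
by move=> [i j] _ /=; rewrite (ord1 i).
Qed.

Lemma ler_rV_norm x i : `|x ord0 i| <= `|x|.
Proof.
rewrite -[leRHS]/(mx_norm x) mx_normrE.
exact: (le_bigmax _ (fun ij : 'I_1 * 'I_d => `|x ij.1 ij.2|) (ord0, i)).
Qed.

End norm_rV.

Lemma ler_powRN {R : realType} (a b s : R) :
  0 < a -> a <= b -> 0 <= s -> b `^ (- s) <= a `^ (- s).
Proof.
move=> a0 ab s0; have b0 := lt_le_trans a0 ab.
rewrite !powRN lef_pV2 ?posrE ?powR_gt0//.
by apply: ge0_ler_powR => //; rewrite nnegrE ltW.
Qed.

Lemma powRVK {R : realType} (a s : R) :
  0 <= a -> s != 0 -> (a `^ s^-1) `^ s = a.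
Proof. by move=> a0 s0; rewrite -powRrM mulVf// powRr1. Qed.

(** * Comparison of the three heights *)

Section height_comparison.
Context {R : realType} {d : nat}.
Hypothesis d0 : (0 < d)%N.
Implicit Type r : 'rV[rat]_d.

Lemma denom_ge1 r i : 1 <= denom r i :> R.
Proof. exact: denq_intr_ge1. Qed.

Lemma denom_le_Hmax r i : denom r i <= Hmax r :> R.
Proof. exact: le_bigmax. Qed.

Lemma Hmin_le_denom r i : Hmin r <= denom r i :> R.
Proof. exact: bigmin_le. Qed.

Lemma denom_le_Hmin r : exists i, denom r i <= Hmin r :> R.
Proof.
pose i0 : 'I_d := Ordinal d0.
have [i _ imin] := @arg_minP _ R _ i0 xpredT (denom r) isT.
(* The default value [Hmax r] of the minimum has to be bounded below as well. *)
exists i; apply/bigmin_geP; split => [|j _]; first exact: denom_le_Hmax.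
exact: imin.
Qed.

Lemma Hmin_gt0 r : 0 < Hmin r :> R.
Proof.
have [i] := denom_le_Hmin r; apply: lt_le_trans.
exact: lt_le_trans ltr01 (denom_ge1 r i).
Qed.

(** [Hmin r] is the [d]-th root of its [d]-th power, so the two products compare factor by
    factor. *)
Lemma Hmin_le_Hprod r : Hmin r <= Hprod r :> R.
Proof.
have H0 := ltW (Hmin_gt0 r).
have dN0 : d%:R != 0 :> R by rewrite pnatr_eq0 -lt0n.
rewrite -[leLHS]powRr1// -(mulfV dN0) powRrM powR_mulrn//.
apply: ge0_ler_powR; rewrite ?invr_ge0// ?nnegrE ?exprn_ge0//.
  by apply: prodr_ge0 => i _; apply: le_trans (denom_ge1 r i).
rewrite -[X in _ ^+ X](card_ord d) -prodr_const.
by apply: ler_prod => i _; rewrite H0 Hmin_le_denom.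
Qed.

Lemma Hprod_le_Hmax r : Hprod r <= Hmax r :> R.
Proof.
have dN0 : d%:R != 0 :> R by rewrite pnatr_eq0 -lt0n.
have H0 : 0 <= Hmax r :> R.
  apply: le_trans (denom_le_Hmax r (Ordinal d0)).
  exact: le_trans ler01 (denom_ge1 r _).
rewrite -[leRHS]powRr1// -(mulfV dN0) powRrM powR_mulrn//.
apply: ge0_ler_powR; rewrite ?invr_ge0// ?nnegrE ?exprn_ge0//.
  by apply: prodr_ge0 => i _; apply: le_trans (denom_ge1 r i).
rewrite -[X in _ ^+ X](card_ord d) -prodr_const.
apply: ler_prod => i _; rewrite denom_le_Hmax andbT.
by apply: le_trans (denom_ge1 r i).
Qed.

(** As [tau >= 0], a sequence admissible for the larger height is admissible for the smaller one. *)
Lemma irr_exponent_le (H H' : 'rV[rat]_d -> R) (x : 'rV[R]_d) :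
  (forall r, 0 < H r) -> (forall r, H r <= H' r) ->
  (irr_exponent H' x <= irr_exponent H x)%E.
Proof.
move=> H0 HH'; apply: le_ereal_sup => _ [tau [tau0 [r [rx rH]]] <-].
exists tau => //; split=> //; exists r; split=> // n.
by apply: lt_le_trans (rH n) _; apply: ler_powRN.
Qed.

End height_comparison.

(** * Diophantine numbers and their approximations *)

(* The exponents [k.+1^-1] suffice, as the condition weakens when the exponent
   grows. *)
Definition diophantine {R : realType} (x : R) := forall k : nat,
  exists2 c : R, 0 < c &
    forall r : rat, c * (denq r)%:~R `^ (- (2 + k.+1%:R^-1)) <= `|x - ratr r|.

Lemma small_invS {R : realType} (e : R) : 0 < e ->
  exists k : nat, k.+1%:R^-1 < e.
Proof.
move=> e0; exists (Num.bound e^-1).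
rewrite -[ltRHS]invrK ltf_pV2 ?posrE ?invr_gt0//.
rewrite (lt_trans (archi_boundP _)) ?invr_ge0 ?ltW//.
by rewrite ltr_nat.
Qed.

(** The bound by [N%:R^-1] is kept to ensure convergence, which the last bound does not give when
    [tau = 0]. *)
Lemma diophantine_approx {R : realType} (x tau : R) : tau < 2 ->
  diophantine x ->
  exists N0 : nat, forall N, (N0 <= N)%N -> (0 < N)%N -> exists r : rat,
    [/\ (denq r)%:~R <= N%:R :> R, `|x - ratr r| < N%:R^-1 &
        `|x - ratr r| < N%:R `^ (- tau)].
Proof.
move=> tau2 dx; have [k ke] : exists k : nat, k.+1%:R^-1 < 2 - tau.
  by apply: small_invS; rewrite subr_gt0.
have [c c0 xc] := dx k; set e := k.+1%:R^-1 in ke xc.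
have e0 : 0 < e by rewrite invr_gt0.
pose s := 1 - (tau - 1) * (1 + e).
have s0 : 0 < s by rewrite /s; nra.
(* From this threshold on, [c^-1 <= N^s], hence [N^(1-s) <= c N]. *)
exists (Num.bound (c^-1 `^ s^-1)) => N N0 Npos.
have NR0 : 0 < N%:R :> R by rewrite ltr0n.
have [r [rN xr]] := dirichlet x N Npos.
set q : R := (denq r)%:~R in rN xr.
have q0 : 0 < q := denq_intr_gt0 r; have q1 : 1 <= q := denq_intr_ge1 r.
exists r; split => //.
  apply: (lt_le_trans xr); rewrite lef_pV2 ?posrE ?mulr_gt0//.
  by rewrite ler_peMl// ltW.
apply: (lt_le_trans xr).
(* Compare the lower bound [c q^-(2+e)] with Dirichlet's upper bound [1/(qN)]. *)
have cN : c * N%:R <= q `^ (1 + e).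
  have := le_trans (xc r) (ltW xr); rewrite -/q.
  have -> : - (2 + e) = - (1 + e) - 1 by lra.
  rewrite powRD ?(gt_eqF q0) ?implybT// powR_inv1 ?(ltW q0)// powRN invfM mulrA.
  rewrite [leRHS]mulrC ler_pM2r ?invr_gt0// ler_pdivrMr ?powR_gt0// => H.
  by rewrite mulrC -ler_pdivlMl.
have Ns : c^-1 <= N%:R `^ s.
  have NR : c^-1 `^ s^-1 <= N%:R.
    rewrite (le_trans (ltW (archi_boundP _))) ?powR_ge0//.
    by rewrite ler_nat.
  rewrite -[leLHS](powRVK _ s) ?invr_ge0 ?(ltW c0) ?gt_eqF//.
  by apply: ge0_ler_powR; rewrite ?nnegrE ?powR_ge0// ltW.
rewrite powRN lef_pV2 ?posrE ?mulr_gt0 ?powR_gt0//.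
have -> : tau = (tau - 1) + 1 by lra.
rewrite powRD ?(gt_eqF NR0) ?implybT// powRr1 ?(ltW NR0)// ler_pM2r//.
(* The goal [N^(tau-1) <= q] is raised to the power [1+e]: it becomes [N^(1-s) <= q^(1+e)], with
   [c N] in between. *)
rewrite leNgt; apply/negP => /(@gt0_ltr_powR _ (1 + e)).
rewrite !nnegrE powR_ge0 (ltW q0) => /(_ _ isT isT).
rewrite addr_gt0// => /(_ isT).
apply/negP; rewrite -leNgt (le_trans _ cN)// -powRrM.
have -> : (tau - 1) * (1 + e) = 1 - s by rewrite /s; lra.
rewrite powRB ?(gt_eqF NR0) ?implybT// powRr1 ?(ltW NR0)//.
rewrite ler_pdivrMr ?powR_gt0// mulrAC ler_peMl ?(ltW NR0)//.
by rewrite -ler_pdivrMl// mulr1.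
Qed.

(** * Exponents at points with diophantine coordinates *)

Section diophantine_exponents.
Context {R : realType} {d : nat}.
Hypothesis d0 : (0 < d)%N.
Variable x : 'rV[R]_d.
Hypothesis dx : forall i, diophantine (x ord0 i).

Lemma irr_exponent_Hmax_ge2 : (2%:E <= irr_exponent Hmax x)%E.
Proof.
apply/lee_subgt0Pr => e e0.
(* [irr_exponent] admits only [tau >= 0], whereas [2 - e] may be negative. *)
pose tau := Num.max 0 (2 - e).
have tau0 : 0 <= tau by rewrite le_max lexx.
have tau2 : tau < 2 by rewrite gt_max; apply/andP; split; lra.
apply: (@le_trans _ _ tau%:E); first by rewrite -EFinB lee_fin le_max lexx orbT.
apply: ereal_sup_ubound; exists tau => //; split => //.
have /choice[N0 N0P] i := diophantine_approx _ _ tau2 (dx i).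
(* A common [N n], above the thresholds of all coordinates, bounds every denominator and hence
   [Hmax]; the term [n.+1] makes the error tend to 0. *)
pose N n := (\max_i N0 i + n.+1)%N.
have /choice[r rP] : forall n, exists r : 'rV[rat]_d, forall i,
    [/\ (denq (r ord0 i))%:~R <= (N n)%:R :> R,
        `|x ord0 i - ratr (r ord0 i)| < (N n)%:R^-1 &
        `|x ord0 i - ratr (r ord0 i)| < (N n)%:R `^ (- tau)].
  move=> n; have /choice[f fP] : forall i, exists r : rat,
    [/\ (denq r)%:~R <= (N n)%:R :> R, `|x ord0 i - ratr r| < (N n)%:R^-1 &
        `|x ord0 i - ratr r| < (N n)%:R `^ (- tau)].
    move=> i; apply: N0P; last by rewrite /N addnS.
    by rewrite (leq_trans (leq_bigmax i))// leq_addr.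
  by exists (\row_i f i) => i; rewrite mxE.
have Npos n : 0 < (N n)%:R :> R by rewrite ltr0n /N addnS.
exists r; split.
  apply/cvgrPdist_lt => e' e'0; have [k ke'] := small_invS _ e'0.
  exists k => // n /= kn; apply: rV_norm_lt => // i; rewrite !mxE.
  have [_ + _] := rP n i; move=> /lt_trans; apply; apply: le_lt_trans ke'.
  by rewrite lef_pV2 ?posrE// ler_nat /N; lia.
move=> n; have H0 : 0 < Hmax (r n) :> R.
  apply: lt_le_trans (denom_le_Hmax _ (Ordinal d0)).
  by apply: lt_le_trans (denom_ge1 _ _).
apply: rV_norm_lt => [|i]; first exact: powR_gt0.
rewrite !mxE; have [_ _ /lt_le_trans] := rP n i; apply.
apply: ler_powRN => //; apply/bigmax_leP; split; first exact: ltW.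
by move=> j _; have [] := rP n j.
Qed.

Lemma irr_exponent_Hmin_le2 : (irr_exponent Hmin x <= 2%:E)%E.
Proof.
apply: ge_ereal_sup => _ [tau [tau0 [r [rx rH]]] <-].
rewrite lee_fin leNgt; apply/negP => tau2.
have [k ke] : exists k : nat, k.+1%:R^-1 < tau - 2.
  by apply: small_invS; rewrite subr_gt0.
set e := k.+1%:R^-1 in ke.
have e0 : 0 < e by rewrite invr_gt0.
have /choice[c cP] : forall i, exists c : R, 0 < c /\
    forall q : rat, c * (denq q)%:~R `^ (- (2 + e)) <= `|x ord0 i - ratr q|.
  by move=> i; have [c c0 cx] := dx i k; exists c.
pose s := tau - (2 + e); have s0 : 0 < s by rewrite /s; lra.
(* [c q^-(2+e) < q^-tau] means [q^s < c^-1], that is, [q < K i]. *)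
pose K i := (c i)^-1 `^ s^-1.
(* A denominator below [K i] in coordinate [i] forces a distance of at least [eps], so a single term
   of the sequence closer than [eps] is contradictory. *)
pose eps := \big[Num.min/1]_i (c i * K i `^ (- (2 + e))).
have K0 i : 0 < K i by rewrite powR_gt0// invr_gt0; case: (cP i).
have eps0 : 0 < eps.
  apply/bigmin_gtP; split => // i _; have [ci _] := cP i.
  by rewrite mulr_gt0// powR_gt0.
have [n _ /(_ n (leqnn n)) xrn] := (cvgrPdist_lt _ _).1 rx _ eps0.
have [i iH] := @denom_le_Hmin R _ d0 (r n).
have [ci cix] := cP i; have /= := cix (r n ord0 i).
set q : R := _%:~R => qx.
have q0 : 0 < q := denq_intr_gt0 _.
have xri : `|x ord0 i - ratr (r n ord0 i)| <= `|x - map_mx ratr (r n)|.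
  by have := ler_rV_norm (x - map_mx ratr (r n)) i; rewrite !mxE.
have qK : q < K i.
  rewrite ltNge; apply/negP => Kq.
  have : c i * q `^ (- (2 + e)) < q `^ (- tau).
    apply: (le_lt_trans qx); apply: (le_lt_trans xri).
    by apply: (lt_le_trans (rH n)); apply: ler_powRN.
  apply/negP; rewrite -leNgt.
  have -> : - tau = - s - (2 + e) by rewrite /s; lra.
  rewrite powRD ?(gt_eqF q0) ?implybT// ler_pM2r ?powR_gt0//.
  rewrite powRN -[leRHS]invrK lef_pV2 ?posrE ?invr_gt0 ?powR_gt0//.
  rewrite -[leLHS](powRVK _ s) ?invr_ge0 ?(ltW ci) ?gt_eqF//.
  by apply: ge0_ler_powR; rewrite ?nnegrE ?powR_ge0// ltW.
have : eps <= `|x - map_mx ratr (r n)|.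
  apply: le_trans xri; apply: le_trans qx.
  apply: (@bigmin_inf _ _ _ _ i) => //; rewrite ler_pM2l//.
  by apply: ler_powRN => //; [exact: ltW|lra].
by rewrite leNgt xrn.
Qed.

Lemma irr_exponent_diophantine :
  [/\ irr_exponent Hmax x = 2%:E, irr_exponent Hprod x = 2%:E &
      irr_exponent Hmin x = 2%:E].
Proof.
have Hp0 (r : 'rV[rat]_d) : 0 < Hprod r :> R.
  by apply: lt_le_trans (Hmin_le_Hprod d0 r); exact: Hmin_gt0.
have le1 := irr_exponent_le _ _ x Hp0 (Hprod_le_Hmax d0).
have le2 := irr_exponent_le _ _ x (@Hmin_gt0 R _ d0) (Hmin_le_Hprod d0).
have ge2 := irr_exponent_Hmax_ge2; have ge2' := le_trans ge2 le1.
have le2' := le_trans le2 irr_exponent_Hmin_le2.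
split; apply: le_anti; apply/andP.
- by split; [exact: le_trans le1 le2'|exact: ge2].
- by split; [exact: le2'|exact: ge2'].
- by split; [exact: irr_exponent_Hmin_le2|exact: le_trans ge2' le2].
Qed.

End diophantine_exponents.

(** * Measure of the neighbourhoods of rationals *)

Section near_rationals.
Context {R : realType}.
Variables (M : nat) (e : R).
Hypothesis e0 : 0 < e.
Local Notation mu := (@lebesgue_measure R).

(** Bounds [|p|] when [p/q] is within 1 of [[-M, M]] and [q <= 2^(j+1)]. *)
Let W j := (M.+1 * 2 ^ j.+1)%N.

Let rho : R := 2 `^ (- e).

Let rho_gt0 : 0 < rho. Proof. exact: powR_gt0. Qed.

Let rho_lt1 : rho < 1.
Proof.
rewrite /rho powRN invf_lt1 ?powR_gt0//.
have := @gt0_ltr_powR R e e0 1 2; rewrite powR1 !nnegrE; apply => //.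
by rewrite ltr1n.
Qed.

(* A pair (numerator shifted by [W j], denominator minus 1) is encoded as the
   remainder and quotient of [n] by [(2 * W j).+1]. *)
Definition rat_ball (c : R) (j n : nat) : set R :=
  ball (((n %% (2 * W j).+1)%:R - (W j)%:R) / (n %/ (2 * W j).+1).+1%:R : R)
       (c * (2 ^+ j) `^ (- (2 + e))).

(** One radius serves all [q] with [2^j <= q < 2^(j+1)]. Smaller denominators and unreduced
    fractions are counted too, which costs only a constant factor. *)
Definition dyadic_near_rat (c : R) (j : nat) : set R :=
  \big[setU/set0]_(n < 2 ^ j.+1 * (2 * W j).+1) rat_ball c j n.

Lemma measurable_dyadic_near_rat c j :
  measurable (dyadic_near_rat c j : set (measurableTypeR R)).
Proof.
by apply: bigsetU_measurable => n _; exact: measurable_realfun.measurable_ball.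
Qed.

(** The factor [4^-j] compensates the number of balls, of order [4^j]; [rho^j] remains and makes the
    sum over [j] converge. *)
Lemma dyadic_radiusE j : (2 ^+ j) `^ (- (2 + e)) = (4 ^+ j)^-1 * rho ^+ j :> R.
Proof.
have -> : - (2 + e) = - 2%:R + - e by lra.
rewrite powRD; last by rewrite expf_neq0 ?implybT.
rewrite powR_invn ?exprn_ge0//; congr (_ * _).
  by rewrite -exprM mulnC exprM (_ : 2 ^+ 2 = 4)// expr2 -natrM.
by rewrite /rho -[2 ^+ j]powR_mulrn// -powRrM mulrC powRrM powR_mulrn ?powR_ge0.
Qed.

(** There are at most [16 (M+1) 4^j] balls, each of length [2 c 4^-j rho^j]. *)
Lemma dyadic_near_rat_measure c j : 0 <= c ->
  (mu (dyadic_near_rat c j) <= (32 * M.+1%:R * c * rho ^+ j)%:E)%E.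
Proof.
move=> c0; have r0 : 0 <= c * (2 ^+ j) `^ (- (2 + e)).
  by rewrite mulr_ge0 ?powR_ge0.
apply: (@le_trans _ _ (\sum_(n < 2 ^ j.+1 * (2 * W j).+1)
    mu (rat_ball c j n))%E).
  apply: content_subadditive => //; last exact: measurable_dyadic_near_rat.
  by move=> k _; exact: measurable_realfun.measurable_ball.
under eq_bigr do rewrite lebesgue_measure_ball//.
rewrite sumEFin sumr_const card_ord lee_fin dyadic_radiusE.
rewrite -[leLHS]mulr_natl -[X in _ * X <= _]mulr_natl.
set u := 4 ^+ j; have u0 : 0 < u :> R by rewrite exprn_gt0.
have -> : (2 ^ j.+1 * (2 * W j).+1)%:R * (2 * (c * (u^-1 * rho ^+ j))) =
    ((2 ^ j.+1 * (2 * W j).+1)%:R * 2 / u) * (c * rho ^+ j) by lra.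
rewrite -[leRHS]mulrA ler_wpM2r ?mulr_ge0 ?exprn_ge0 ?(ltW rho_gt0)//.
rewrite ler_pdivrMr// /u -!natrX -!natrM ler_nat /W.
rewrite (_ : 4 ^ j = 2 ^ j * 2 ^ j)%N; last by rewrite -expnMn.
rewrite !expnS; have := expn_gt0 2 j; set a := (2 ^ j)%N => /=; nia.
Qed.

Lemma near_rat_cover (c x : R) (r : rat) : 0 < c -> c <= 1 -> `|x| <= M%:R ->
  `|x - ratr r| < c * (denq r)%:~R `^ (- (2 + e)) ->
  (\bigcup_j dyadic_near_rat c j) x.
Proof.
move=> c0 c1 xM xr.
have [q qE] : exists q : nat, denq r = q%:Z.
  by exists `|denq r|%N; rewrite gtz0_abs// denq_gt0.
have q0 : (0 < q)%N by have := denq_gt0 r; rewrite qE.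
rewrite qE -pmulrn in xr.
have /= /andP[jq qj] := trunc_log_bounds (isT : (1 < 2)%N) q0.
set j := trunc_log 2 q in jq qj; exists j => //.
have q0R : 0 < q%:R :> R by rewrite ltr0n.
have q1R : 1 <= q%:R :> R by rewrite ler1n.
have rE : ratr r = (numq r)%:~R / q%:R :> R.
  by rewrite /ratr qE -pmulrn.
(* Since [c <= 1], the fraction is within 1 of [x], which bounds its numerator by [(M+1) q]. *)
have xr1 : `|x - ratr r| < 1.
  apply: (lt_le_trans xr); rewrite -[leRHS]mulr1 ler_pM ?powR_ge0 ?(ltW c0)//.
  have := @ler_powRN R 1 q%:R (2 + e) ltr01 q1R; rewrite powR1; apply.
  by rewrite addr_ge0// ltW.
have pW : `|numq r| <= (W j)%:Z.
  have : `|(numq r)%:~R| <= M.+1%:R * q%:R :> R.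
    rewrite -ler_pdivrMr// -[X in _ / X]gtr0_norm// -normf_div -rE -natr1.
    have -> : ratr r = x - (x - ratr r) by lra.
    by rewrite (le_trans (ler_normB _ _))// lerD// ltW.
  rewrite -natrM pmulrn -intr_norm ler_int => /le_trans; apply.
  by rewrite lez_nat /W leq_mul2l/= ltnW.
have [p pE] : exists p : nat, numq r + (W j)%:Z = p%:Z.
  exists `|(numq r + (W j)%:Z)%R|%N; rewrite gez0_abs//.
  by move: pW; clear; lia.
have pB : (p < (2 * W j).+1)%N by move: pW pE; clear; lia.
(* The code of [r]: quotient [q - 1], remainder [numq r + W j]. *)
pose n := (q.-1 * (2 * W j).+1 + p)%N.
have nlt : (n < 2 ^ j.+1 * (2 * W j).+1)%N.
  rewrite /n; apply: (@leq_trans (q * (2 * W j).+1)%N).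
    by rewrite -[in leqRHS](prednK q0) (mulSnr q.-1) ltn_add2l.
  by rewrite leq_mul2r (ltnW qj) orbT.
rewrite /dyadic_near_rat -bigcup_mkord; exists n => //.
rewrite /rat_ball /n modnMDl modn_small// divnMDl// divn_small// addn0 prednK//.
have -> : p%:R - (W j)%:R = (numq r)%:~R :> R.
  by apply/eqP; rewrite subr_eq !pmulrn -intrD pE.
rewrite -rE /ball/= distrC; apply: (lt_le_trans xr).
rewrite ler_pM2l//; apply: ler_powRN.
- by rewrite exprn_gt0.
- by rewrite -natrX ler_nat.
- by rewrite addr_ge0 ?ltW.
Qed.

(** If every [c] fails, then [c = 1/(k+1)] fails for each [k], so [x] lies in all the [E k], whose
    measures are [O(1/(k+1))]. *)
Lemma very_well_approximable_negligible :
  mu.-negligible [set x : measurableTypeR R | `|x| <= M%:R /\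
    ~ exists2 c : R, 0 < c &
      forall r : rat, c * (denq r)%:~R `^ (- (2 + e)) <= `|x - ratr r|].
Proof.
pose E k : set (measurableTypeR R) := \bigcup_j dyadic_near_rat k.+1%:R^-1 j.
have mE k : measurable (E k).
  by apply: bigcup_measurable => j _; exact: measurable_dyadic_near_rat.
(* [C / (k+1)] is the sum over [j] of the geometric bounds for [c = 1/(k+1)]. *)
pose C : R := 32 * M.+1%:R / (1 - rho).
have C0 : 0 <= C by rewrite divr_ge0// subr_ge0 ltW.
have muE k : (mu (E k) <= (C * k.+1%:R^-1)%:E)%E.
  apply: (@le_trans _ _
      (\big[+%E/0%E]_(0 <= j <oo) mu (dyadic_near_rat k.+1%:R^-1 j))%E).
    apply: measure_sigma_subadditive => //.
    by move=> j; exact: measurable_dyadic_near_rat.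
  apply: lime_le; first exact: is_cvg_nneseries.
  apply: nearW => n.
  apply: (@le_trans _ _
      (\sum_(0 <= j < n) (32 * M.+1%:R * k.+1%:R^-1 * rho ^+ j)%:E)%E).
    by apply: lee_sum => j _; apply: dyadic_near_rat_measure; rewrite invr_ge0.
  rewrite sumEFin lee_fin.
  have -> : C * k.+1%:R^-1 = (32 * M.+1%:R * k.+1%:R^-1) / (1 - rho).
    by rewrite /C mulrAC.
  by apply: geometric_le_lim => //; rewrite gtr0_norm.
exists (\bigcap_k E k); split; first exact: bigcapT_measurable.
  apply/eqP; rewrite eq_le measure_ge0 andbT; apply/lee_addgt0Pr => z z0.
  have C1 : 0 < C + 1 by rewrite ltr_wpDl.
  rewrite add0e; have [k kz] := small_invS _ (divr_gt0 z0 C1).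
  apply: (@le_trans _ _ (mu (E k))).
    apply: le_measure; rewrite ?inE//; first exact: bigcapT_measurable.
    exact: bigcap_inf.
  apply: (le_trans (muE k)); rewrite lee_fin.
  move: kz; rewrite ltr_pdivlMr// => /ltW; apply: le_trans.
  by rewrite mulrC ler_pM2l ?invr_gt0// lerDl.
move=> x [xM nx] k _; apply: contrapT => nE; apply: nx.
exists k.+1%:R^-1 => [|r]; first by rewrite invr_gt0.
rewrite leNgt; apply/negP => xr; apply: nE; apply: (near_rat_cover _ _ r) => //.
by rewrite invf_le1 ?ltr0n// ler1n.
Qed.

End near_rationals.

(** * Almost every point has diophantine coordinates *)

(** Countably many null sets suffice: one for each exponent index [k] and each bound [M] on
    [|x|]. *)
Lemma diophantine_ae {R : realType} :
  {ae @lebesgue_measure R, forall x : measurableTypeR R, diophantine (x : R)}.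
Proof.
apply: ae_foralln => k.
apply: (@negligibleS _ _ _ _ (\bigcup_M [set x : measurableTypeR R |
  `|x| <= M%:R /\ ~ exists2 c : R, 0 < c & forall r : rat,
    c * (denq r)%:~R `^ (- (2 + k.+1%:R^-1)) <= `|x - ratr r|])).
  move=> x nx; exists (Num.bound x) => //; split => //.
  by rewrite ltW// unstable.ltr_norm_bound.
apply: negligible_bigcup => M; apply: very_well_approximable_negligible.
by rewrite invr_gt0.
Qed.

(** The exceptional set lies in a box with side [N] in direction [i] and full sides elsewhere; its
    measure is 0 even if the other factors are infinite, as [0 * oo = 0]. *)
Lemma lebesgue_tuple_ae_tnth {R : realType} {d : nat} (i : 'I_d)
    (P : measurableTypeR R -> Prop) :
  {ae @lebesgue_measure R, forall x, P x} ->
  {ae lebesgue_tuple R d, forall t, P (tnth t i)}.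
Proof.
move=> [N [mN N0 PN]].
pose A (j : 'I_d) : set (measurableTypeR R) := if j == i then N else setT.
have mA j : measurable (A j) by rewrite /A; case: ifP.
have AE : [set t : d.-tuple _ | forall j, A j (tnth t j)] =
    (fun t : d.-tuple (measurableTypeR R) => tnth t i) @^-1` N.
  apply/seteqP; split => t /=; first by move=> /(_ i); rewrite /A eqxx.
  by move=> Nt j; rewrite /A; case: eqP => // ->.
exists [set t | forall j, A j (tnth t j)]; split.
- by rewrite AE -[X in measurable X]setTI; exact: measurable_tnth.
- by rewrite lebesgue_tuple_box// (bigD1 i)//= /A eqxx N0 mul0e.
- by rewrite AE => t nt; exact: PN.
Qed.

Theorem theorem1p2 (R : realType) (d : nat) (hd : (1 <= d)%N) :
  {ae lebesgue_tuple R d, forall t : d.-tuple (measurableTypeR R),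
    [/\ irr_exponent Hmax (row_of_tuple t) = 2%:E,
        irr_exponent Hprod (row_of_tuple t) = 2%:E &
        irr_exponent Hmin (row_of_tuple t) = 2%:E] }.
Proof.
have dae (i : 'I_d) :
    {ae lebesgue_tuple R d, forall t, diophantine (tnth t i : R)}.
  exact: lebesgue_tuple_ae_tnth diophantine_ae.
have aeF := ae_filter_ringOfSetsType (lebesgue_tuple R d).
apply: (@filterS _ _ aeF _ _ _ (@filter_forall _ _ _ _ aeF dae)) => t dt.
by apply: irr_exponent_diophantine => // i; rewrite mxE.
Qed.
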